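(* Let $K$ be a field and let $R$ be a maximal subring of $K$ which is not a field. Let $\mathcal{A}$ be the set of all maximal subrings of $K$ which are isomorphic to $R$. Then $|\mathrm{Aut}(K)|\geq|\mathcal{A}|$ and $\mathcal{A}=\{\sigma(R)\mid \sigma\in \mathrm{Aut}(K)\}$. In particular, if $|\mathrm{Aut}(K)|=1$, then for any two distinct maximal subrings $S$ and $R$ of $K$ which are not fields, $R\ncong S$.
   Context: All rings are commutative with $1\neq 0$; subrings and homomorphisms are unital. A proper subring $S$ of a ring $T$ is a maximal subring of $T$ if it is maximal with respect to inclusion among the proper subrings of $T$. $\mathrm{Aut}(K)$ is the set of all field automorphisms of $K$. Isomorphic means isomorphic as rings. *)

(* Defs.v *)
From mathcomp Require Import all_boot all_order all_algebra.
From mathcomp Require Import boolp classical_sets functions cardinality.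

Set Implicit Arguments.
Unset Strict Implicit.
Unset Printing Implicit Defensive.

Import GRing.Theory.
Local Open Scope classical_set_scope.
Local Open Scope ring_scope.

Definition subring (T : nzRingType) (S : set T) : Prop :=
  subring_closed [in S].

Definition proper_subring (T : nzRingType) (S : set T) : Prop :=
  subring S /\ S <> setT.

Definition maximal_subring (T : nzRingType) (S : set T) : Prop :=
  proper_subring S /\
  forall S' : set T, proper_subring S' -> S `<=` S' -> S' = S.

(* For a subring S of a commutative ring; 1 != 0 is inherited from T. *)
Definition is_field (T : comNzRingType) (S : set T) : Prop :=
  forall x, S x -> x != 0 -> exists2 y, S y & x * y = 1.

(* The isomorphism A -> B is represented by a map on the ambient rings, of
   which only the restriction to A matters: f is not assumed to be a morphism
   outside A. *)
Definition ring_isomorphic (T U : nzRingType) (A : set T) (B : set U) : Prop :=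
  exists f : T -> U,
    [/\ set_bij A B f, f 1 = 1,
        {in A &, {morph f : x y / x + y}} &
        {in A &, {morph f : x y / x * y}}].

Definition field_aut (K : fieldType) : set (K -> K) :=
  [set s : K -> K | [/\ zmod_morphism s, monoid_morphism s & bijective s]].
Arguments field_aut K : clear implicits.

Definition maximal_subrings_iso (K : fieldType) (R : set K) : set (set K) :=
  [set S | maximal_subring S /\ ring_isomorphic S R].

(* Main.v *)
(** A maximal subring [R] of [K] that is not a field has fraction field [K],
    because its fraction field inside [K] is a subring strictly larger than
    [R].  Hence an isomorphism between two such subrings extends, by
    [a / b |-> f a / f b], to an automorphism of [K]; so the maximal subrings
    isomorphic to [R] form the orbit of [R] under [Aut(K)]. *)
Require Import Defs.
From HB Require Import structures.
From mathcomp Require Import all_boot all_order all_algebra.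
From mathcomp Require Import boolp classical_sets functions cardinality.
From mathcomp Require Import ring.

Import GRing.Theory.
Local Open Scope classical_set_scope.
Local Open Scope card_scope.
Local Open Scope ring_scope.

Lemma subringP {T : nzRingType} {S : set T} :
  subring S <-> [/\ S 1, (forall x y, S x -> S y -> S (x - y)) &
                    (forall x y, S x -> S y -> S (x * y))].
Proof.
split=> [[/set_mem S1 SB SM]|[S1 SB SM]].
  by split=> // x y Sx Sy; apply/set_mem; [apply: SB|apply: SM]; exact: mem_set.
split; first exact: mem_set.
  by move=> x y /set_mem Sx /set_mem Sy; apply/mem_set/SB.
by move=> x y /set_mem Sx /set_mem Sy; apply/mem_set/SM.
Qed.

Lemma subring0 {T : nzRingType} {S : set T} : subring S -> S 0.
Proof. by move=> /subringP[S1 SB _]; rewrite -(subrr 1); exact: SB. Qed.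

Definition fractions {K : fieldType} (S : set K) : set K :=
  [set x | exists a b, [/\ S a, S b, b != 0 & x = a / b]].

Lemma sub_fractions {K : fieldType} {S : set K} : subring S -> S `<=` fractions S.
Proof.
by move=> /subringP[S1 _ _] x Sx; exists x, 1; rewrite oner_neq0 divr1.
Qed.

Lemma subring_fractions {K : fieldType} {S : set K} :
  subring S -> subring (fractions S).
Proof.
move=> Sr; have /subringP[S1 SB SM] := Sr; apply/subringP; split.
- exact: (sub_fractions Sr).
- move=> _ _ [a [b [Sa Sb b0 ->]]] [c [d [Sc Sd d0 ->]]].
  exists (a * d - c * b), (b * d).
  split; [by apply: SB; apply: SM|exact: SM|by rewrite mulf_neq0|].
  by field; rewrite b0 d0.
- move=> _ _ [a [b [Sa Sb b0 ->]]] [c [d [Sc Sd d0 ->]]].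
  exists (a * c), (b * d).
  split; [exact: SM|exact: SM|by rewrite mulf_neq0|].
  by field; rewrite b0 d0.
Qed.

(** If [fractions S] were proper, maximality would force it to equal [S]; then [1 / x] would lie in
    [S] for every nonzero [x] of [S], making [S] a field. *)
Lemma fractions_maximal {K : fieldType} {S : set K} :
  maximal_subring S -> ~ is_field S -> fractions S = setT.
Proof.
move=> [[Sr _] Smax] nF; apply: contrapT => FT; apply: nF => x Sx x0.
have /subringP[S1 _ _] := Sr.
exists x^-1; last by rewrite mulfV.
rewrite -(Smax _ (conj (subring_fractions Sr) FT) (sub_fractions Sr)).
by exists 1, x; rewrite div1r.
Qed.

(** Injectivity is automatic for a ring morphism out of a field, so any section of [s] is a
    two-sided inverse. *)
Lemma surj_morphism_field_aut {K : fieldType} {s : K -> K} :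
  zmod_morphism s -> monoid_morphism s -> (forall y, exists x, s x = y) ->
  field_aut K s.
Proof.
move=> sB sM surj; split=> //.
pose g : {rmorphism K -> K} := HB.pack s
  (GRing.isZmodMorphism.Build _ _ s sB) (GRing.isMonoidMorphism.Build _ _ s sM).
have [t tK] := choice surj.
by exists t => // x; apply: (fmorph_inj g); exact: tK.
Qed.

Lemma field_aut_id (K : fieldType) : field_aut K id.
Proof. by apply: surj_morphism_field_aut => // y; exists y. Qed.

Lemma field_aut_inv {K : fieldType} {s : K -> K} : field_aut K s ->
  exists t, [/\ field_aut K t, cancel s t & cancel t s].
Proof.
move=> [sB [s1 sM] [t sK tK]]; exists t; split=> //.
apply: surj_morphism_field_aut; last by move=> y; exists (s y).
- by move=> x y; apply: (can_inj sK); rewrite sB !tK.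
- by split=> [|x y]; apply: (can_inj sK); rewrite ?sM !tK ?s1.
Qed.

Lemma image_cancel {T U : Type} {s : T -> U} {t : U -> T} (sK : cancel s t) (A : set T) :
  t @` (s @` A) = A.
Proof.
by rewrite image_comp; under eq_imagel do rewrite /= sK;
   rewrite image_id.
Qed.

Lemma subring_image_aut {K : fieldType} {s : K -> K} {S : set K} :
  field_aut K s -> subring S -> subring (s @` S).
Proof.
move=> [sB [s1 sM] _] /subringP[S1 SB SM]; apply/subringP; split.
- by exists 1.
- by move=> _ _ [x Sx <-] [y Sy <-]; exists (x - y); rewrite ?sB//; exact: SB.
- by move=> _ _ [x Sx <-] [y Sy <-]; exists (x * y); rewrite ?sM//; exact: SM.
Qed.

Lemma proper_subring_image_aut {K : fieldType} {s : K -> K} {S : set K} :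
  field_aut K s -> proper_subring S -> proper_subring (s @` S).
Proof.
move=> sA [Sr ST]; split; first exact: subring_image_aut.
have [t [_ sK tK]] := field_aut_inv sA.
move=> sT; apply: ST; rewrite -(image_cancel sK S) sT.
by apply/seteqP; split=> // x _; exists (s x).
Qed.

Lemma maximal_subring_image_aut {K : fieldType} {s : K -> K} {S : set K} :
  field_aut K s -> maximal_subring S -> maximal_subring (s @` S).
Proof.
move=> sA [Sp Smax]; split; first exact: proper_subring_image_aut.
have [t [tA sK tK]] := field_aut_inv sA.
move=> S' S'p sS.
(* Maximality of [S] is applied to [S'] pulled back along the inverse [t]. *)
rewrite -(image_cancel tK S') (Smax (t @` S'))//.
  exact: proper_subring_image_aut.
by rewrite -{1}(image_cancel sK S); exact: image_subset.
Qed.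

Lemma ring_isomorphic_image_aut {K : fieldType} {s : K -> K} {S : set K} :
  field_aut K s -> ring_isomorphic (s @` S) S.
Proof.
move=> sA; have [t [[tB tM tbij] sK tK]] := field_aut_inv sA.
pose g : {rmorphism K -> K} := HB.pack t
  (GRing.isZmodMorphism.Build _ _ t tB) (GRing.isMonoidMorphism.Build _ _ t tM).
exists t; split.
- split.
  + by move=> _ [x Sx <-] /=; rewrite sK.
  + by move=> x y _ _; exact: (bij_inj tbij).
  + by move=> x Sx; exists (s x); [exists x|rewrite sK].
- exact: tM.1.
- by move=> x y _ _; exact: (rmorphD g).
- by move=> x y _ _; exact: tM.2.
Qed.

Lemma ring_isomorphic_not_field {K : fieldType} {A B : set K} :
  subring A -> ring_isomorphic A B -> ~ is_field B -> ~ is_field A.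
Proof.
move=> Ar [f [[fAB finj fsurj] f1 fD fM]] nF AF; apply: nF => y By y0.
have [x Ax fx] := fsurj _ By; subst y.
have A0 := subring0 Ar.
(* [f] is additive on [A] only, so this cancels in [f (0 + 0)], with [0] in [A]. *)
have f0 : f 0 = 0.
  by apply: (addrI (f 0)); rewrite -fD ?addr0//; exact: mem_set.
have x0 : x != 0 by apply: contraNneq y0 => ->; rewrite f0.
have [z Az xz] := AF _ Ax x0.
by exists (f z); [exact: fAB|rewrite -fM ?xz//; exact: mem_set].
Qed.

Lemma ring_isomorphic_extend {K : fieldType} {A B : set K} :
  subring A -> fractions A = setT -> fractions B = setT ->
  ring_isomorphic A B -> exists2 s, field_aut K s & s @` A = B.
Proof.
move=> Ar FA FB [f [[fAB finj fsurj] f1 fD' fM']].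
have /subringP[A1 AB AM] := Ar; have A0 := subring0 Ar.
have fD x y : A x -> A y -> f (x + y) = f x + f y.
  by move=> Ax Ay; apply: fD'; exact: mem_set.
have fM x y : A x -> A y -> f (x * y) = f x * f y.
  by move=> Ax Ay; apply: fM'; exact: mem_set.
have f0 : f 0 = 0 by apply: (addrI (f 0)); rewrite -fD ?addr0.
have fB x y : A x -> A y -> f (x - y) = f x - f y.
  by move=> Ax Ay; apply: (addIr (f y)); rewrite -fD ?subrK//; exact: AB.
have fN0 x : A x -> x != 0 -> f x != 0.
  move=> Ax; apply: contra_neq => fx0.
  by apply: finj; rewrite ?f0//; exact: mem_set.
(* Choice fixes one representation of each element of [K] as a fraction over [A]; [s] is defined
   through it. *)
have /choice[p pP] (x : K) : exists q : K * K,
    [/\ A q.1, A q.2, q.2 != 0 & x = q.1 / q.2].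
  have [a [b abP]] : fractions A x by rewrite FA.
  by exists (a, b).
pose s x := f (p x).1 / f (p x).2.
(* The value of [s] does not depend on the chosen fraction: equality of fractions becomes an
   equality of cross products in [A], which [f] preserves. *)
have sE a b : A a -> A b -> b != 0 -> s (a / b) = f a / f b.
  move=> Aa Ab b0; rewrite /s; case: (pP (a / b)) => Ac Ad d0.
  move/eqP; rewrite eqr_div// => /eqP e.
  apply/eqP; rewrite eqr_div ?fN0// -!fM//; apply/eqP; congr f.
  by rewrite e.
have sA a : A a -> s a = f a.
  by move=> Aa; rewrite -[a in LHS]divr1 sE ?oner_neq0// f1 divr1.
exists s.
  apply: surj_morphism_field_aut.
  - move=> x y; have [Aa Ab b0 ->] := pP x; have [Ac Ad d0 ->] := pP y.
    (* By [sE] any representatives will do, so the chosen ones are generalized. *)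
    move: (p x).1 (p x).2 (p y).1 (p y).2 Aa Ab b0 Ac Ad d0 => a b c d *.
    have -> : a / b - c / d = (a * d - c * b) / (b * d).
      by field; apply/andP.
    rewrite !sE ?mulf_neq0//; [|by apply: AB; apply: AM|exact: AM].
    rewrite fB ?fM//; [|exact: AM|exact: AM].
    by field; rewrite !fN0.
  - split; first by rewrite sA.
    move=> x y; have [Aa Ab b0 ->] := pP x; have [Ac Ad d0 ->] := pP y.
    move: (p x).1 (p x).2 (p y).1 (p y).2 Aa Ab b0 Ac Ad d0 => a b c d *.
    rewrite mulf_div !sE ?mulf_neq0//; [|exact: AM|exact: AM].
    by rewrite !fM// mulf_div.
  (* Surjectivity: write [y] as a fraction over [B] and lift numerator and denominator to [A]
     separately. *)
  - move=> y; have [c [d [Bc Bd d0 ->]]] : fractions B y by rewrite FB.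
    have [a Aa fa] := fsurj _ Bc; have [b Ab fb] := fsurj _ Bd.
    exists (a / b); rewrite sE ?fa ?fb//.
    by apply: contraNneq d0 => b0; rewrite -fb b0 f0.
apply/seteqP; split=> [_ [x Ax <-]|y By]; first by rewrite sA//; exact: fAB.
by have [x Ax fx] := fsurj _ By; exists x; rewrite ?sA.
Qed.

Lemma maximal_subrings_iso_orbit {K : fieldType} {R : set K} :
  maximal_subring R -> ~ is_field R ->
  maximal_subrings_iso R = [set s @` R | s in field_aut K].
Proof.
move=> Rm RnF; apply/seteqP; split=> [S [Sm SR]|_ [s sA <-]]; last first.
  by split; [exact: maximal_subring_image_aut|exact: ring_isomorphic_image_aut].
(* Membership in the family does not state that [S] is not a field; this is transported from [R], so
   that [K] is also the fraction field of [S]. *)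
have SnF := ring_isomorphic_not_field Sm.1.1 SR RnF.
have [s sA <-] := ring_isomorphic_extend Sm.1.1 (fractions_maximal Sm SnF)
  (fractions_maximal Rm RnF) SR.
(* The extension [s] carries [S] onto [R]; the orbit of [R] needs its inverse. *)
have [t [tA sK _]] := field_aut_inv sA.
by exists t => //; exact: image_cancel.
Qed.

Theorem proposition3p18 (K : fieldType) :
  (forall R : set K, maximal_subring R -> ~ is_field R ->
     maximal_subrings_iso R #<= field_aut K /\
     maximal_subrings_iso R = [set s @` R | s in field_aut K]) /\
  (field_aut K #= `I_1 ->
   forall R S : set K,
     maximal_subring R -> ~ is_field R ->
     maximal_subring S -> ~ is_field S ->
     S <> R -> ~ ring_isomorphic R S).
Proof.
split=> [R Rm RnF|K1 R S Rm RnF Sm SnF neqSR RS].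
  rewrite maximal_subrings_iso_orbit//; split=> //; exact: card_image_le.
apply: neqSR.
have [s sA sS] : [set s @` S | s in field_aut K] R.
  by rewrite -maximal_subrings_iso_orbit.
have /card_set_bijP[h [hK1 hinj _]] := K1.
have s_id : s = id.
  have idA := field_aut_id K.
  apply: hinj; [exact: mem_set|exact: mem_set|].
  by have := hK1 _ sA; have := hK1 _ idA; rewrite /= !ltnS !leqn0 => /eqP -> /eqP.
by rewrite -sS s_id image_id.
Qed.
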